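(* Let $\mathcal{H}$ be a real Hilbert space, $K\subset\mathcal{H}$ a nonempty closed convex set, and $F:\mathcal{H}\to\mathcal{H}$ an operator such that: (C1) $\Omega_D\neq\emptyset$; (C2) $F$ is quasimonotone and $L$-Lipschitz continuous on $\mathcal{H}$ (with $L>0$); (C3) whenever a sequence $\{x_k\}\subset\mathcal{H}$ converges weakly to $x$, one has $\|F(x)\|\le\liminf_{k\to\infty}\|F(x_k)\|$; (C4) with $A:=\{u\in K:F(u)=0\}\setminus\Omega_D$, for every $p\in\Omega_D$ there exists $\delta_p>0$ such that $\|y_1-y_2\|\ge 2\delta_p$ for any two distinct points $y_1,y_2\in A_p:=\{p\}\cup A$. Let $\lambda\in(0,\frac1L)$ and let $x(t),y(t)$, $t\ge 0$, be the trajectories generated by $$\begin{cases} y(t)=P_K(x(t)-\lambda F(x(t))),\\ \dot x(t)+x(t)=y(t)+\lambda\,[F(x(t))-F(y(t))],\\ x(0)=x_0\in\mathcal{H}.\end{cases}$$ Suppose moreover that, for a given $\epsilon\ge 0$, (C5) $y(t)\in K$ for all $t$ and $$\liminf_{t\to\infty}\frac{|\langle F(y(t)),y(t)-u\rangle|}{\|y(t)-u\|^{2+\epsilon}}>0,\qquad\forall u\in K.$$ Then the time-average $$\bar x(T):=\frac1T\int_0^T x(t)\,dt$$ converges strongly, as $T\to\infty$, to a point of $\Omega$.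
   Context: $P_K$ is the metric projection onto $K$. $\Omega:=\{x^*\in K:\langle F(x^* ),y-x^*\rangle\ge 0\ \ \forall y\in K\}$ is the solution set of the variational inequality $VI(F,K)$, and $\Omega_D:=\{x^*\in K:\langle F(y),y-x^*\rangle\ge 0\ \ \forall y\in K\}$. $F$ is quasimonotone on a set $S$ if for all $\xi,\eta\in S$, $\langle F(\xi),\eta-\xi\rangle>0$ implies $\langle F(\eta),\eta-\xi\rangle\ge 0$; in (C2) this is meant with $S=\mathcal{H}$. $F$ is $L$-Lipschitz if $\|F(\xi)-F(\eta)\|\le L\|\xi-\eta\|$ for all $\xi,\eta\in\mathcal{H}$. The trajectory $x:[0,\infty)\to\mathcal{H}$ exists and is unique by the global Cauchy–Lipschitz theorem. *)

(* Defs.v *)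
From Stdlib Require Export Reals.
From Coquelicot Require Export Coquelicot.

Open Scope R_scope.

(* A real Hilbert space: a complete normed space whose norm comes from an
   inner product. Symmetry makes linearity in the first argument enough, and
   [inner_norm] gives positive definiteness. *)
Record HilbertSpace : Type := {
  hilbert_space :> CompleteNormedModule R_AbsRing;
  inner : hilbert_space -> hilbert_space -> R;
  inner_sym : forall u v, inner u v = inner v u;
  inner_plus_l : forall u v w, inner (plus u v) w = inner u w + inner v w;
  inner_scal_l : forall (a : R) u v, inner (scal a u) v = a * inner u v;
  inner_norm : forall u, inner u u = (norm u) ^ 2
}.

Arguments inner {h} _ _.

Section Notions.

Context {H : HilbertSpace}.
Implicit Types (K : H -> Prop) (F : H -> H).

Definition convex_set K : Prop :=
  forall u v (a : R), K u -> K v -> 0 <= a <= 1 ->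
    K (plus (scal a u) (scal (1 - a) v)).

(* [is_metric_projection K z p] says that p = P_K(z). *)
Definition is_metric_projection K (z p : H) : Prop :=
  K p /\ forall w, K w -> norm (minus z p) <= norm (minus z w).

(* Solutions of the variational inequality VI(F, K), and of its dual (Minty)
   form [Omega_D]. *)
Definition Omega F K (u : H) : Prop :=
  K u /\ forall v, K v -> 0 <= inner (F u) (minus v u).

Definition Omega_D F K (u : H) : Prop :=
  K u /\ forall v, K v -> 0 <= inner (F v) (minus v u).

Definition quasimonotone_on (S : H -> Prop) F : Prop :=
  forall u v, S u -> S v ->
    0 < inner (F u) (minus v u) -> 0 <= inner (F v) (minus v u).

Definition lipschitz (L : R) F : Prop :=
  forall u v, norm (minus (F u) (F v)) <= L * norm (minus u v).

Definition weakly_converges (s : nat -> H) (u : H) : Prop :=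
  forall v, is_lim_seq (fun k => inner (s k) v) (inner u v).

Definition spurious_zeros F K (u : H) : Prop :=
  K u /\ F u = zero /\ ~ Omega_D F K u.

(* The derivative of x at t relative to the half-line [0, +oo): one-sided at
   t = 0, and independent of the values of x at negative times. *)
Definition is_derive_halfline (x : R -> H) (t : R) (v : H) : Prop :=
  filterdiff x (within (fun s => 0 <= s) (locally t)) (fun h : R => scal h v).

Definition is_trajectory F K (lambda : R) (x0 : H) (x y : R -> H) : Prop :=
  x 0 = x0 /\
  forall t : R, 0 <= t ->
    is_metric_projection K (minus (x t) (scal lambda (F (x t)))) (y t) /\
    exists dx : H,
      is_derive_halfline x t dx /\
      plus dx (x t) = plus (y t) (scal lambda (minus (F (x t)) (F (y t)))).

End Notions.

(* The lower limit, as t -> +oo, of a real function f with domain D: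
   sup over T of inf { f t | t >= T, D t }, in the extended reals, with
   inf of the empty set = +oo. *)
Definition LimInf_infty (D : R -> Prop) (f : R -> R) : Rbar :=
  Rbar_lub (fun l => exists T : R,
    l = Glb_Rbar (fun r => exists t : R, T <= t /\ D t /\ r = f t)).

(* Main.v *)
From Stdlib Require Import Lra Psatz Classical.
Require Import Defs.

(** Fix p in [Omega_D]. Testing the projection inequality for y(t) at p and
    using the Lipschitz bound on F(x) - F(y) shows that the squared distance
    |x(t) - p|^2 decreases at rate at least
    2 (lambda <F(y), y - p> + (1 - lambda L) |x - y|^2), where both terms are
    nonnegative: the first because p is a dual solution, the second because
    lambda L < 1 ([energy_dissipation]).

    The liminf hypothesis at u = p makes <F(y), y - p> bounded below by a
    positive constant as long as |y - p| stays away from 0 and t is large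
    ([inner_pos_away_from_dual_solution]). While |x - p| >= eps, one of |y - p|
    and |x - y| is at least eps/2, so the dissipation rate is bounded below by a
    positive constant. A nonnegative energy cannot decrease at such a rate
    forever, hence |x - p| eventually drops below eps, and stays there by
    monotonicity: x(t) itself converges strongly to p ([trajectory_cvg]).
    Time averages inherit the limit ([time_average_cvg]), and p solves the
    primal inequality by Minty's argument ([Omega_D_sub_Omega]). *)

(** * Inner product calculus *)

Section InnerProduct.

Context {H : HilbertSpace}.
Implicit Types u v w z p : H.

Lemma inner_plus_r u v w : inner u (plus v w) = inner u v + inner u w.
Proof. rewrite 3!(inner_sym H u). apply inner_plus_l. Qed.

Lemma inner_scal_r (a : R) u v : inner u (scal a v) = a * inner u v.
Proof. rewrite 2!(inner_sym H u). apply inner_scal_l. Qed.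

Lemma inner_opp_l u v : inner (opp u) v = - inner u v.
Proof.
  replace (opp u) with (scal (- 1) u) by exact (scal_opp_one (K := R_AbsRing) u).
  rewrite inner_scal_l. ring.
Qed.

Lemma inner_minus_l u v w : inner (minus u v) w = inner u w - inner v w.
Proof. unfold minus. rewrite inner_plus_l, inner_opp_l. ring. Qed.

Lemma inner_minus_r u v w : inner u (minus v w) = inner u v - inner u w.
Proof. rewrite 3!(inner_sym H u). apply inner_minus_l. Qed.

(** The norm is given as a norm, so the triangle inequality for u + v, squared
    and expanded, already contains the Cauchy-Schwarz inequality. *)
Lemma Rabs_inner_le_norm u v : Rabs (inner u v) <= norm u * norm v.
Proof.
  assert (upper : forall u', inner u' v <= norm u' * norm v).
  { intros u'.
    assert (tri : norm (plus u' v) <= norm u' + norm v) by exact (norm_triangle u' v).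
    assert (sq := inner_norm H (plus u' v)).
    rewrite inner_plus_l, 2!inner_plus_r, 2!inner_norm, (inner_sym H v u') in sq.
    assert (tri_sq := pow_incr _ _ 2 (conj (norm_ge_0 _) tri)).
    rewrite <- sq in tri_sq. lra. }
  apply Rabs_le; split; [ | apply upper].
  assert (low := upper (opp u)). rewrite inner_opp_l in low.
  replace (norm (opp u)) with (norm u) in low by (symmetry; exact (norm_opp u)).
  lra.
Qed.

End InnerProduct.

(* Sums formed in a Hilbert space may reach the group structure along different
   coercion paths; the arguments are therefore matched syntactically and each
   rewriting step is checked up to conversion. *)
Ltac inner_expand :=
  repeat match goal with
  | |- context [inner (@minus ?G ?u ?v) ?w] =>
      replace (inner (@minus G u v) w) with (inner u w - inner v w)
        by (symmetry; exact (inner_minus_l u v w))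
  | |- context [inner (@plus ?G ?u ?v) ?w] =>
      replace (inner (@plus G u v) w) with (inner u w + inner v w)
        by (symmetry; exact (inner_plus_l _ u v w))
  | |- context [inner (@scal ?A ?G ?a ?v) ?w] =>
      replace (inner (@scal A G a v) w) with (a * inner v w)
        by (symmetry; exact (inner_scal_l _ a v w))
  | |- context [inner ?w (@minus ?G ?u ?v)] =>
      replace (inner w (@minus G u v)) with (inner w u - inner w v)
        by (symmetry; exact (inner_minus_r w u v))
  | |- context [inner ?w (@plus ?G ?u ?v)] =>
      replace (inner w (@plus G u v)) with (inner w u + inner w v)
        by (symmetry; exact (inner_plus_r w u v))
  | |- context [inner ?w (@scal ?A ?G ?a ?v)] =>
      replace (inner w (@scal A G a v)) with (a * inner w v)
        by (symmetry; exact (inner_scal_r a w v))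
  end.
Ltac inner_expand_in h := revert h; inner_expand; intros h.

(** * Variational inequalities *)

(** First-order conditions on segments of a convex set all end here: dividing by
    the parameter a leaves an error of order a. *)
Lemma nonpos_of_le_small_multiple (b c : R) :
  (forall a, 0 < a <= 1 -> b <= a * c) -> b <= 0.
Proof.
  intros small.
  (* If b > 0, the parameter a = b / (2 c) gives b <= b / 2. *)
  destruct (Rle_lt_dec b 0) as [ | bpos]; [assumption | exfalso].
  assert (h1 : b <= 1 * c) by (apply small; lra).
  assert (cpos : 0 < c) by lra.
  assert (quot : b / (2 * c) * c = b / 2) by (field; lra).
  assert (h2 : 0 < b / (2 * c)) by (apply Rdiv_lt_0_compat; lra).
  assert (h3 : b / (2 * c) <= 1) by nra.
  assert (h4 := small _ (conj h2 h3)). lra.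
Qed.

Section VariationalInequality.

Context {H : HilbertSpace}.
Implicit Types (K : H -> Prop) (F : H -> H) (p v z : H).

(** The point a v + (1 - a) p of K is no closer to z than p; the first-order term
    in a of the two squared distances gives the inequality. *)
Lemma metric_projection_inner K z p v :
  convex_set K -> is_metric_projection K z p -> K v ->
  inner (minus z p) (minus v p) <= 0.
Proof.
  intros Kconv [Kp closest] Kv.
  apply (nonpos_of_le_small_multiple _ (inner (minus v p) (minus v p) / 2)).
  intros a arange.
  assert (Kw : K (plus (scal a v) (scal (1 - a) p)))
    by (apply Kconv; [assumption .. | lra]).
  assert (closer := pow_incr _ _ 2 (conj (norm_ge_0 _) (closest _ Kw))).
  rewrite <- 2!inner_norm in closer.
  inner_expand_in closer. inner_expand.
  rewrite ?(inner_sym H v z), ?(inner_sym H p z), ?(inner_sym H p v) in *.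
  apply (Rmult_le_reg_l a); lra.
Qed.

(** Minty's argument: the dual inequality at w = p + a (v - p), divided by a, reads
    0 <= <F(w), v - p>, and F(w) tends to F(p) as a tends to 0. *)
Lemma Omega_D_sub_Omega K F (L : R) p :
  convex_set K -> lipschitz L F -> Omega_D F K p -> Omega F K p.
Proof.
  intros Kconv Flip [Kp dual]. split; [assumption | intros v Kv].
  cut (- inner (F p) (minus v p) <= 0); [lra | ].
  apply (nonpos_of_le_small_multiple _ (L * norm (minus v p) ^ 2)).
  intros a arange.
  set (w := plus (scal a v) (scal (1 - a) p)).
  assert (Kw : K w) by (apply Kconv; [assumption .. | lra]).
  assert (dual_w := dual w Kw).
  assert (step : forall z, inner z (minus w p) = a * inner z (minus v p))
    by (intros z; unfold w; inner_expand; ring).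
  rewrite step in dual_w.
  assert (dual_v : 0 <= inner (F w) (minus v p)) by nra.
  assert (step_norm : norm (minus w p) = a * norm (minus v p)).
  { apply Rsqr_inj; [apply norm_ge_0 | apply Rmult_le_pos; [lra | apply norm_ge_0] | ].
    rewrite 2!Rsqr_pow2, <- inner_norm, step, (inner_sym H _ (minus v p)), step,
      inner_norm. ring. }
  assert (cs := Rle_trans _ _ _ (Rle_abs _)
                  (Rabs_inner_le_norm (minus (F w) (F p)) (minus v p))).
  assert (lip : norm (minus (F w) (F p)) <= L * norm (minus w p))
    by exact (Flip w p).
  rewrite step_norm in lip. rewrite (inner_minus_l (F w)) in cs.
  assert (n0 := norm_ge_0 (minus v p)). nra.
Qed.

(** The left side is half the derivative of |x - p|^2 along the flow. As
    - dx = (x - lambda F(x)) - y + lambda F(y), the projection inequality at p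
    bounds <dx, y - p> by - lambda <F(y), y - p>; the remaining term <dx, x - y>
    is - |x - y|^2 up to the Lipschitz error lambda L |x - y|^2. *)
Lemma energy_dissipation K F (L lambda : R) x y dx p :
  convex_set K -> lipschitz L F -> 0 <= lambda ->
  is_metric_projection K (minus x (scal lambda (F x))) y ->
  plus dx x = plus y (scal lambda (minus (F x) (F y))) -> K p ->
  inner dx (minus x p)
    <= - (lambda * inner (F y) (minus y p)
          + (1 - lambda * L) * norm (minus x y) ^ 2).
Proof.
  intros Kconv Flip lpos proj flow Kp.
  assert (vi := metric_projection_inner _ _ _ p Kconv proj Kp).
  assert (flow_inner : forall w, inner dx w
     = inner y w - inner x w + lambda * (inner (F x) w - inner (F y) w)).
  { intros w. assert (e := f_equal (fun s => inner s w) flow).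
    cbv beta in e. inner_expand_in e. lra. }
  assert (cs := Rle_trans _ _ _ (Rle_abs _)
                  (Rabs_inner_le_norm (minus (F x) (F y)) (minus x y))).
  assert (lip : norm (minus (F x) (F y)) <= L * norm (minus x y))
    by exact (Flip x y).
  assert (n0 := norm_ge_0 (minus x y)).
  assert (cs' : lambda * inner (minus (F x) (F y)) (minus x y)
                <= lambda * (L * norm (minus x y) ^ 2)).
  { apply Rmult_le_compat_l; [assumption | nra]. }
  assert (sq := inner_norm H (minus x y)).
  rewrite flow_inner.
  replace ((1 - lambda * L) * norm (minus x y) ^ 2) with
    (inner (minus x y) (minus x y) - lambda * (L * norm (minus x y) ^ 2))
    by (rewrite sq; ring).
  clear lip cs sq flow_inner.
  inner_expand_in vi. inner_expand_in cs'. inner_expand.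
  rewrite ?(inner_sym H y x) in *.
  lra.
Qed.

End VariationalInequality.

(** * One-sided derivatives *)

Lemma derive_halfline_approx (H : HilbertSpace) (x : R -> H) t (v : H) :
  0 <= t -> is_derive_halfline x t v ->
  forall eps, 0 < eps -> exists d, 0 < d /\
    forall s, 0 <= s -> Rabs (s - t) < d ->
      norm (minus (minus (x s) (x t)) (scal (s - t) v)) <= eps * Rabs (s - t).
Proof.
  intros tpos [_ dom] eps epos.
  destruct (dom t (filter_le_within _) (mkposreal eps epos)) as [d near].
  exists d. split; [apply cond_pos | ].
  intros s spos close. exact (near s close spos).
Qed.

(** At t > 0 the derivative along the half-line is two-sided. With r the
    first-order remainder of x and D its increment, the increment of |x - p|^2
    differs from its linear part by 2 <r, x - p> + |D|^2, which is o(h). *)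
Lemma is_derive_norm_sq (H : HilbertSpace) (x : R -> H) (p : H) t (v : H) :
  0 < t -> is_derive_halfline x t v ->
  is_derive (fun s => norm (minus (x s) p) ^ 2) t (2 * inner v (minus (x t) p)).
Proof.
  intros tpos der.
  apply is_derive_Reals. intros eps epos.
  set (w := minus (x t) p).
  assert (w0 := norm_ge_0 w). assert (v0 := norm_ge_0 v).
  (* Relative precision at which 2 <r, w> stays below half of eps |h|; the bound
     by 1 gives |D| <= (1 + |v|) |h|. *)
  set (e1 := Rmin 1 (eps / (4 * (norm w + 1)))).
  assert (e1pos : 0 < e1).
  { apply Rmin_glb_lt; [lra | apply Rdiv_lt_0_compat; lra]. }
  assert (e1w : e1 * norm w < eps / 4).
  { assert (le := Rmin_r 1 (eps / (4 * (norm w + 1)))). fold e1 in le.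
    assert (eq : eps / (4 * (norm w + 1)) * (norm w + 1) = eps / 4) by (field; lra).
    nra. }
  assert (e1one : e1 <= 1) by apply Rmin_l.
  destruct (derive_halfline_approx _ _ _ _ (Rlt_le _ _ tpos) der e1 e1pos)
    as [d [dpos approx]].
  set (C := (1 + norm v) ^ 2).
  assert (Cpos : 1 <= C) by (unfold C; nra).
  assert (bound_pos : 0 < Rmin (Rmin d t) (eps / (4 * C))).
  { repeat apply Rmin_glb_lt; try assumption. apply Rdiv_lt_0_compat; lra. }
  exists (mkposreal _ bound_pos). intros h hne hsmall. simpl in hsmall.
  assert (hd : Rabs h < d).
  { eapply Rlt_le_trans; [exact hsmall | ].
    eapply Rle_trans; [apply Rmin_l | apply Rmin_l]. }
  assert (ht : Rabs h < t).
  { eapply Rlt_le_trans; [exact hsmall | ].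
    eapply Rle_trans; [apply Rmin_l | apply Rmin_r]. }
  assert (hC : C * Rabs h < eps / 2).
  { assert (hC' : Rabs h < eps / (4 * C)).
    { eapply Rlt_le_trans; [exact hsmall | apply Rmin_r]. }
    assert (eq : C * (eps / (4 * C)) = eps / 4) by (field; lra). nra. }
  apply Rabs_def2 in ht.
  assert (hpos : 0 < Rabs h) by now apply Rabs_pos_lt.
  assert (near := approx (t + h)).
  replace (t + h - t) with h in near by ring.
  specialize (near ltac:(lra) hd).
  set (r := minus (minus (x (t + h)) (x t)) (scal h v)) in *.
  set (D := minus (x (t + h)) (x t)).
  assert (Dsmall : norm D <= (1 + norm v) * Rabs h).
  { assert (e : D = plus r (scal h v)).
    { unfold r, D, minus at 2. rewrite <- plus_assoc, plus_opp_l, plus_zero_r.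
      reflexivity. }
    rewrite e.
    apply (Rle_trans _ (norm r + norm (scal h v)));
      [exact (norm_triangle r (scal h v)) | ].
    assert (sc : norm (scal h v) <= Rabs h * norm v) by exact (norm_scal h v).
    nra. }
  assert (D0 := norm_ge_0 D).
  assert (Dsq : inner D D <= C * Rabs h * Rabs h).
  { rewrite inner_norm. unfold C. nra. }
  assert (Dsq0 : 0 <= inner D D) by (rewrite inner_norm; nra).
  assert (rw := Rabs_inner_le_norm r w).
  assert (expand : norm (minus (x (t + h)) p) ^ 2 - norm w ^ 2
     - h * (2 * inner v w) = 2 * inner r w + inner D D).
  { rewrite <- 2!inner_norm. unfold r, D, w. inner_expand.
    rewrite ?(inner_sym H (x t) (x (t + h))), ?(inner_sym H p (x t)),
       ?(inner_sym H p (x (t + h))).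
    ring. }
  replace ((norm (minus (x (t + h)) p) ^ 2 - norm w ^ 2) / h
     - 2 * inner v w) with ((2 * inner r w + inner D D) / h)
    by (rewrite <- expand; field; assumption).
  rewrite Rabs_div by assumption.
  apply (Rmult_lt_reg_r (Rabs h)); [assumption | ].
  unfold Rdiv. rewrite Rmult_assoc, Rinv_l, Rmult_1_r by lra.
  eapply Rle_lt_trans; [apply Rabs_triang | ].
  rewrite Rabs_mult, (Rabs_pos_eq 2), (Rabs_pos_eq _ Dsq0) by lra.
  assert (linear_part := Rmult_le_compat_r _ _ _ w0 near).
  assert (linear_small := Rmult_lt_compat_r _ _ _ hpos e1w).
  assert (square_small := Rmult_lt_compat_r _ _ _ hpos hC).
  lra.
Qed.

(** A mean value inequality that asks only for the existence of a derivative at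
    each point, so that no derivative function has to be chosen. *)
Lemma increment_le_of_derive_le (f : R -> R) (a b k : R) :
  a <= b ->
  (forall t, a <= t <= b -> exists l, is_derive f t l /\ l <= k) ->
  f b - f a <= k * (b - a).
Proof.
  intros ab der.
  destruct (MVT_gen f a b (Derive f)) as [c [crange eq]];
    rewrite ?Rmin_left, ?Rmax_right in * by assumption.
  - intros t trange. destruct (der t) as [l [dl _]]; [lra | ].
    apply Derive_correct. now exists l.
  - intros t trange. destruct (der t trange) as [l [dl _]].
    apply derivable_continuous_pt. exists l. now apply is_derive_Reals.
  - destruct (der c crange) as [l [dl lk]].
    rewrite (is_derive_unique _ _ _ dl) in eq. rewrite eq.
    apply Rmult_le_compat_r; lra.
Qed.

(** * Time averages *)

Lemma continuous_Rmax_0 (t : R) :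
  filterlim (Rmax 0) (locally t) (within (fun s => 0 <= s) (locally (Rmax 0 t))).
Proof.
  intros P [d near]. exists d. intros s close.
  apply near; [ | apply Rmax_l].
  change (Rabs (s - t) < d) in close. change (Rabs (Rmax 0 s - Rmax 0 t) < d).
  revert close. unfold Rmax.
  destruct (Rle_dec 0 s), (Rle_dec 0 t); unfold Rabs;
    repeat destruct Rcase_abs; lra.
Qed.

Lemma minus_scal_inv (V : ModuleSpace R_Ring) (k c : R) (u l : V) :
  k * c = 1 -> minus (scal k u) l = scal k (minus u (scal c l)).
Proof.
  intros inv. rewrite scal_minus_distr_l, scal_assoc.
  change (mult k c) with (k * c). rewrite inv.
  f_equal. symmetry. exact (scal_one (K := R_Ring) l).
Qed.

(** Split the deviation integral at a time T0 after which f is eps/2-close to l: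
    the initial piece is a fixed vector, killed by the factor 1/T, and the tail
    contributes at most eps/2. *)
Lemma time_average_cvg (V : CompleteNormedModule R_AbsRing) (f : R -> V) (l : V) :
  (forall t, 0 <= t ->
     filterlim f (within (fun s => 0 <= s) (locally t)) (locally (f t))) ->
  (forall eps, 0 < eps -> exists T, forall t, T <= t -> norm (minus (f t) l) < eps) ->
  filterlim (fun T : R => scal (/ T) (RInt f 0 T))
    (Rbar_locally p_infty) (locally l).
Proof.
  intros cont lim.
  (* The integral from 0 ignores negative times, where f may be discontinuous. *)
  set (g := fun t => f (Rmax 0 t)).
  assert (gcont : forall t, continuous g t).
  { intros t. unfold g, continuous.
    eapply filterlim_comp; [apply continuous_Rmax_0 | apply cont, Rmax_l]. }
  assert (gint : forall a b, ex_RInt g a b)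
    by (intros a b; apply ex_RInt_continuous; intros; apply gcont).
  assert (gcint : forall a b, ex_RInt (fun t => minus (g t) l) a b).
  { intros a b. apply (ex_RInt_minus (V := V)); [apply gint | apply ex_RInt_const]. }
  apply (filterlim_locally_ball_norm (K := R_AbsRing) (U := V)). intros eps.
  assert (epos := cond_pos eps).
  destruct (lim (eps / 2)) as [T1 tail]; [lra | ].
  set (T0 := Rmax 0 T1).
  set (I0 := RInt (fun t => minus (g t) l) 0 T0).
  assert (I0pos := norm_ge_0 I0).
  assert (T0pos : 0 <= T0) by apply Rmax_l.
  (* Past this time norm I0 / T < eps / 4. *)
  exists (T0 + 4 * norm I0 / eps + 1). intros T Tbig.
  assert (quot : 4 * norm I0 / eps * eps = 4 * norm I0) by (field; lra).
  assert (quot0 : 0 <= 4 * norm I0 / eps).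
  { apply Rmult_le_pos; [lra | apply Rlt_le, Rinv_0_lt_compat, epos]. }
  assert (Tpos : 0 < T) by lra.
  assert (same : RInt f 0 T = RInt g 0 T).
  { apply RInt_ext. intros t. rewrite Rmin_left, Rmax_right by lra.
    intros trange. unfold g. now rewrite Rmax_right by lra. }
  assert (deviation : minus (scal (/ T) (RInt f 0 T)) l
    = scal (/ T) (plus I0 (RInt (fun t => minus (g t) l) T0 T))).
  { unfold I0. rewrite RInt_Chasles by apply gcint.
    rewrite (RInt_minus (V := V)) by (apply gint || apply ex_RInt_const).
    rewrite RInt_const, same.
    apply (minus_scal_inv V). field. lra. }
  set (I1 := RInt (fun t => minus (g t) l) T0 T) in *.
  apply (Rle_lt_trans _ (Rabs (/ T) * norm (plus I0 I1))).
  { apply (Rle_trans _ (norm (scal (/ T) (plus I0 I1)))).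
    - apply Req_le, f_equal, deviation.
    - exact (norm_scal (/ T) (plus I0 I1)). }
  rewrite Rabs_pos_eq by (apply Rlt_le, Rinv_0_lt_compat, Tpos).
  assert (tail_int : norm I1 <= (T - T0) * (eps / 2)).
  { apply norm_RInt_le_const with (f := fun t => minus (g t) l) (a := T0) (b := T).
    - lra.
    - intros t trange. apply Rlt_le. unfold g. rewrite Rmax_right by lra.
      apply tail. eapply Rle_trans; [apply (Rmax_r 0) | apply trange].
    - apply RInt_correct, gcint. }
  assert (tri : norm (plus I0 I1) <= norm I0 + norm I1)
    by exact (norm_triangle I0 I1).
  apply (Rmult_lt_reg_l T); [assumption | ].
  rewrite <- Rmult_assoc, Rinv_r, Rmult_1_l by lra.
  nra.
Qed.

(** * Convergence of the trajectory *)

Lemma LimInf_infty_pos (D : R -> Prop) (f : R -> R) :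
  Rbar_lt 0 (LimInf_infty D f) ->
  exists c T : R, 0 < c /\ forall t, T <= t -> D t -> c <= f t.
Proof.
  intros pos.
  destruct (classic (exists T, Rbar_lt 0
     (Glb_Rbar (fun r => exists t : R, T <= t /\ D t /\ r = f t)))) as [[T posT] | none].
  - destruct (Glb_Rbar_correct (fun r => exists t : R, T <= t /\ D t /\ r = f t))
      as [lower _].
    destruct (Glb_Rbar _) as [c | | ]; simpl in posT.
    + exists c, T. split; [assumption | ].
      intros t Tt Dt. apply (lower (f t)). now exists t.
    + (* Infimum +oo: no point of D lies beyond T. *)
      exists 1, T. split; [lra | ].
      intros t Tt Dt. destruct (lower (f t)). now exists t.
    + contradiction.
  - exfalso. apply (Rbar_lt_not_le _ _ pos).
    unfold LimInf_infty, Rbar_lub.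
    destruct (Rbar_ex_lub _) as [l [upper least]]. simpl. apply least.
    intros _ [T ->]. apply Rbar_not_lt_le. intros posT. apply none. now exists T.
Qed.

(** The growth hypothesis bounds the absolute value by c |y - p|^q for large t;
    since p is a dual solution, the absolute value can be dropped. The time T
    does not depend on the distance r. *)
Lemma inner_pos_away_from_dual_solution (H : HilbertSpace) (K : H -> Prop) (F : H -> H)
    (y : R -> H) (p : H) (q : R) :
  Omega_D F K p -> (forall t, 0 <= t -> K (y t)) -> 0 <= q ->
  Rbar_lt 0
    (LimInf_infty (fun t => 0 <= t /\ y t <> p)
       (fun t => Rabs (inner (F (y t)) (minus (y t) p))
                 / Rpower (norm (minus (y t) p)) q)) ->
  exists T, forall r, 0 < r -> exists m, 0 < m /\
    forall t, T <= t -> 0 <= t -> r <= norm (minus (y t) p) ->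
      m <= inner (F (y t)) (minus (y t) p).
Proof.
  intros [_ dual] yK qpos growth.
  destruct (LimInf_infty_pos _ _ growth) as [c [T [cpos lower]]].
  exists T. intros r rpos. exists (c * Rpower r q).
  assert (Rpos : 0 < Rpower r q) by apply exp_pos.
  split; [now apply Rmult_lt_0_compat | ].
  intros t Tt tpos far.
  assert (ne : y t <> p).
  { intros e. rewrite e in far.
    replace (minus p p) with (zero : H) in far
      by (symmetry; exact (minus_eq_zero p)).
    replace (norm (zero : H)) with 0 in far
      by (symmetry; exact (norm_zero (V := H))).
    lra. }
  assert (low := lower t Tt (conj tpos ne)).
  rewrite Rabs_pos_eq in low by (apply dual; auto).
  assert (mono := Rle_Rpower_l r (norm (minus (y t) p)) q qpos (conj rpos far)).
  set (P := Rpower (norm (minus (y t) p)) q) in *.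
  set (a := inner (F (y t)) (minus (y t) p)) in *.
  assert (e : a = a / P * P) by (field; lra). nra.
Qed.

(** The energy |x - p|^2 is monotone, so it suffices to reach the eps-ball once:
    staying outside on a long time interval would make the energy negative. *)
Lemma trajectory_cvg (H : HilbertSpace) (K : H -> Prop) (F : H -> H)
    (L lambda q : R) (x0 : H) (x y : R -> H) (p : H) :
  convex_set K -> lipschitz L F -> 0 < lambda -> lambda * L < 1 ->
  is_trajectory F K lambda x0 x y -> Omega_D F K p -> 0 <= q ->
  Rbar_lt 0
    (LimInf_infty (fun t => 0 <= t /\ y t <> p)
       (fun t => Rabs (inner (F (y t)) (minus (y t) p))
                 / Rpower (norm (minus (y t) p)) q)) ->
  forall eps, 0 < eps -> exists T, forall t, T <= t -> norm (minus (x t) p) < eps.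
Proof.
  intros Kconv Flip lpos step [_ traj] dualp qpos growth eps epos.
  assert (yK : forall t, 0 <= t -> K (y t)) by (intros t t0; apply (traj t t0)).
  destruct (inner_pos_away_from_dual_solution _ _ _ _ _ _ dualp yK qpos growth) as [T0 away].
  destruct (away (eps / 2)) as [m [mpos escape]]; [lra | ]. clear away growth.
  destruct dualp as [Kp dual].
  set (E := fun t => norm (minus (x t) p) ^ 2).
  assert (der : forall t, 0 < t -> exists l, is_derive E t (2 * l) /\
    l <= - (lambda * inner (F (y t)) (minus (y t) p)
            + (1 - lambda * L) * norm (minus (x t) (y t)) ^ 2)).
  { intros t tpos. destruct (traj t) as [proj [dx [dxt flow]]]; [lra | ].
    exists (inner dx (minus (x t) p)). split.
    - now apply is_derive_norm_sq.
    - eapply energy_dissipation; eauto; lra. }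
  assert (decreasing : forall s t, 0 < s <= t -> E t <= E s).
  { intros s t st.
    cut (E t - E s <= 0 * (t - s)); [lra | ].
    apply increment_le_of_derive_le; [lra | ].
    intros r rrange. destruct (der r) as [l [dl lle]]; [lra | ].
    exists (2 * l). split; [assumption | ].
    assert (d0 := dual (y r) (yK r ltac:(lra))).
    assert (sq := pow2_ge_0 (norm (minus (x r) (y r)))).
    assert (p1 := Rmult_le_pos lambda _ (Rlt_le _ _ lpos) d0).
    assert (p2 := Rmult_le_pos (1 - lambda * L) _ ltac:(lra) sq). lra. }
  set (rate := Rmin (lambda * m) ((1 - lambda * L) * (eps / 2) ^ 2)).
  assert (rate_pos : 0 < rate) by (apply Rmin_glb_lt;
    apply Rmult_lt_0_compat; try apply pow_lt; lra).
  assert (dissipates : forall t, 0 < t -> T0 <= t -> eps <= norm (minus (x t) p) ->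
    exists l, is_derive E t l /\ l <= - rate).
  { intros t tpos Tt far. destruct (der t tpos) as [l [dl lle]].
    exists (2 * l). split; [assumption | ].
    assert (d0 := dual (y t) (yK t ltac:(lra))).
    assert (split_norm : norm (minus (x t) p)
        <= norm (minus (x t) (y t)) + norm (minus (y t) p)).
    { replace (minus (x t) p) with (plus (minus (x t) (y t)) (minus (y t) p))
        by (symmetry; exact (minus_trans (y t) (x t) p)).
      exact (norm_triangle (minus (x t) (y t)) (minus (y t) p)). }
    destruct (Rle_lt_dec (eps / 2) (norm (minus (y t) p))) as [yfar | yclose].
    - assert (big := escape t Tt ltac:(lra) yfar).
      assert (sq := pow2_ge_0 (norm (minus (x t) (y t)))).
      assert (rl : rate <= lambda * m) by apply Rmin_l.
      assert (p1 := Rmult_le_compat_l lambda _ _ (Rlt_le _ _ lpos) big).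
      assert (p2 := Rmult_le_pos (1 - lambda * L) _ ltac:(lra) sq). lra.
    - assert (big : (eps / 2) ^ 2 <= norm (minus (x t) (y t)) ^ 2)
        by (apply pow_incr; lra).
      assert (rl : rate <= (1 - lambda * L) * (eps / 2) ^ 2) by apply Rmin_r.
      assert (p1 := Rmult_le_pos lambda _ (Rlt_le _ _ lpos) d0).
      assert (p2 := Rmult_le_compat_l (1 - lambda * L) _ _ ltac:(lra) big). lra. }
  (* A start at positive time, since at 0 only a one-sided derivative is given. *)
  set (a := Rmax 1 T0).
  assert (a1 : 1 <= a) by apply Rmax_l. assert (aT : T0 <= a) by apply Rmax_r.
  assert (Epos : forall t, 0 <= E t) by (intros t; apply pow2_ge_0).
  (* Dissipating at this rate from a to b would cost E a + 1. *)
  set (b := a + (E a + 1) / rate).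
  assert (quot : (E a + 1) / rate * rate = E a + 1) by (field; lra).
  assert (ab : a <= b).
  { assert (0 < (E a + 1) / rate).
    { apply Rdiv_lt_0_compat; [assert (e := Epos a); lra | assumption]. }
    unfold b. lra. }
  exists b. intros t bt. apply Rnot_le_lt. intros far.
  assert (far_before : forall s, a <= s <= b -> eps <= norm (minus (x s) p)).
  { intros s srange. assert (dec := decreasing s t ltac:(lra)). unfold E in dec.
    assert (n0 := norm_ge_0 (minus (x s) p)). nra. }
  assert (drop := increment_le_of_derive_le E a b (- rate) ab).
  assert (dropped : E b - E a <= - rate * (b - a)).
  { apply drop. intros s srange. apply dissipates; [lra .. | now apply far_before]. }
  assert (eb := Epos b). unfold b in dropped at 2.
  nra.
Qed.

Theorem theorem3p10
  (H : HilbertSpace) (K : H -> Prop) (F : H -> H)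
  (L lambda epsilon : R) (x0 : H) (x y : R -> H)
  (K_nonempty : exists u, K u)
  (K_closed : closed K)
  (K_convex : convex_set K)
  (C1 : exists p, Omega_D F K p)
  (L_pos : 0 < L)
  (C2_quasimonotone : quasimonotone_on (fun _ => True) F)
  (C2_lipschitz : lipschitz L F)
  (C3 : forall (s : nat -> H) (u : H), weakly_converges s u ->
     Rbar_le (norm (F u)) (LimInf_seq (fun k => norm (F (s k)))))
  (C4 : forall p, Omega_D F K p ->
     exists delta : R, 0 < delta /\
       forall y1 y2 : H,
         (y1 = p \/ spurious_zeros F K y1) ->
         (y2 = p \/ spurious_zeros F K y2) ->
         y1 <> y2 -> 2 * delta <= norm (minus y1 y2))
  (lambda_range : 0 < lambda < 1 / L)
  (xy_trajectory : is_trajectory F K lambda x0 x y)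
  (epsilon_nonneg : 0 <= epsilon)
  (C5_in_K : forall t, 0 <= t -> K (y t))
  (C5_liminf : forall u, K u ->
     Rbar_lt 0
       (LimInf_infty (fun t => 0 <= t /\ y t <> u)
          (fun t => Rabs (inner (F (y t)) (minus (y t) u))
                    / Rpower (norm (minus (y t) u)) (2 + epsilon)))) :
  exists xbar : H,
    Omega F K xbar /\
    filterlim (fun T : R => scal (/ T) (RInt x 0 T))
      (Rbar_locally p_infty) (locally xbar).
Proof.
  destruct C1 as [p dualp].
  exists p. split.
  - eapply Omega_D_sub_Omega; eassumption.
  - apply (time_average_cvg H).
    + intros t tpos. destruct xy_trajectory as [_ traj].
      destruct (traj t tpos) as [_ [dx [der _]]].
      apply (filterdiff_continuous_aux (U := R_NormedModule) (V := H) x);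
        [ | apply filter_le_within].
      exists (fun h : R => scal h dx). exact der.
    + assert (step : lambda * L < 1).
      { assert (e : 1 / L * L = 1) by (field; lra). nra. }
      apply (trajectory_cvg H K F L lambda (2 + epsilon) x0 x y p);
        try assumption; try lra.
      apply C5_liminf, dualp.
Qed.
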